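(* Let $G$ be an abelian group with a skew-symmetric bicharacter $r$, let $F$ be a field, and let $V=\bigoplus_{g\in G}V_g$ be a $G$-graded vector space over $F$ with $\dim V_g<\infty$ for every $g\in G$. Let $L$ be a finite-dimensional solvable Lie color subalgebra of $gl(\{V_g\},F)$ such that every homogeneous element of $[L,L]$ is nilpotent. If $G$ is torsion-free, then $L$ stabilizes some color flag in $V$; in other words, the matrices of the elements of $L$ relative to a suitable homogeneous basis of $V$ are upper triangular.
   Context: A skew-symmetric bicharacter on an abelian group $G$ is a map $r:G\times G\to F\setminus\{0\}$ with $r(g+h,k)=r(g,k)r(h,k)$, $r(g,h+k)=r(g,h)r(g,k)$ and $r(g,h)r(h,g)=1$ for all $g,h,k\in G$. For a $G$-graded vector space $V=\bigoplus_{g\in G}V_g$ over $F$ with every $V_g$ finite-dimensional, put $A_{gh}=\operatorname{Hom}_F(V_h,V_g)$ for $g,h\in G$, viewed as endomorphisms of $V$ that vanish on $V_k$ for $k\neq h$. Let $A=\sum_{i,j\in G}A_{ij}$ (finite sums), graded by $A_g=\sum_{i=j+g}A_{ij}$. Write $|a|$ for the degree of a homogeneous element $a$; a homogeneous element is one lying in a single graded component, and a homogeneous basis is one consisting of homogeneous elements. The general linear Lie color algebra $gl(\{V_g\},F)$ is $A$ with the bracket given on homogeneous elements by $[a,b]=ab-r(|b|,|a|)ba$ and extended bilinearly. A Lie color subalgebra is a $G$-graded subspace closed under the bracket; $[L,L]$ is the linear span of all brackets of elements of $L$. $L$ is solvable if its derived series $L^{(0)}=L$, $L^{(k+1)}=[L^{(k)},L^{(k)}]$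 reaches $0$. Nilpotent means nilpotent as an endomorphism of $V$. A color flag in $V$ is a flag of $G$-graded subspaces, namely the chain of subspaces spanned by the initial segments of an ordered homogeneous basis of $V$ (when $\dim V=n<\infty$, this is a chain of $G$-graded subspaces $0=W_0\subseteq W_1\subseteq\cdots\subseteq W_n=V$ with $\dim W_i=i$). $L$ stabilizes the flag if $x(W)\subseteq W$ for all $x\in L$ and all members $W$ of the flag.
   Formalization: The field F is additionally assumed to be algebraically closed; over any other field the claim fails, e.g. for F = Q, V = V_0 = Q^2 and L spanned by the rotation matrix [[0,-1],[1,0]], which is abelian but has no eigenvector. *)

(* Defs.v *)
From HB Require Import structures.
From mathcomp Require Import all_boot all_order all_algebra.
From mathcomp Require Import all_classical.

Set Implicit Arguments.
Unset Strict Implicit.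
Unset Printing Implicit Defensive.

Import Order.TTheory GRing.Theory.

Local Open Scope classical_set_scope.
Local Open Scope ring_scope.

Definition torsion_free (G : zmodType) : Prop :=
  forall (g : G) (n : nat), (0 < n)%N -> g *+ n = 0 -> g = 0.

Definition skew_bicharacter (G : zmodType) (F : fieldType)
    (r : G -> G -> F) : Prop :=
  [/\ forall g h, r g h != 0,
      forall g h k, r (g + h) k = r g k * r h k,
      forall g h k, r g (h + k) = r g h * r g k &
      forall g h, r g h * r h g = 1].

Section LinearAlgebra.
Variables (F : fieldType) (W : lmodType F).
Implicit Types (S : set W) (w : W).

Definition is_subspace S : Prop := GRing.submod_closed [in S].

Definition lspan S : set W :=
  [set w | exists (n : nat) (c : 'I_n -> F) (s : 'I_n -> W),
     (forall i, S (s i)) /\ w = \sum_(i < n) c i *: s i].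

Definition fin_dim S : Prop :=
  exists (n : nat) (s : 'I_n -> W), S = lspan (range s).

(* The sums over setT below are finitely supported sums. *)
Definition coordinates (I : choiceType) (e : I -> W) w (c : I -> F) : Prop :=
  finite_set [set i | c i != 0] /\ w = \sum_(i \in [set: I]) c i *: e i.

Definition basis (I : choiceType) (e : I -> W) : Prop :=
  forall w, exists! c : I -> F, coordinates e w c.

Definition coordinate (I : choiceType) (e : I -> W) w : I -> F :=
  xget (fun=> 0) (coordinates e w).

End LinearAlgebra.

Section Gradings.
Variables (G : zmodType) (F : fieldType) (W : lmodType F) (W_ : G -> set W).

Definition decomposition (w : W) (f : G -> W) : Prop :=
  [/\ finite_set [set g | f g != 0], forall g, W_ g (f g) &
      w = \sum_(g \in [set: G]) f g].

Definition direct_sum : Prop :=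
  (forall g, is_subspace (W_ g)) /\
  forall w, exists! f : G -> W, decomposition w f.

Definition component (w : W) : G -> W := xget (fun=> 0) (decomposition w).

Definition homogeneous (w : W) : Prop := exists g, W_ g w.

Definition graded_subspace (S : set W) : Prop :=
  is_subspace S /\
  forall w, S w -> exists2 f, decomposition w f & forall g, S (f g).

End Gradings.

(* Endomorphisms of V are plain functions satisfying [linear]; the type
   V -> V carries the pointwise vector space structure. *)
Section ColorAlgebra.
Variables (G : zmodType) (F : fieldType) (r : G -> G -> F).
Variables (V : lmodType F) (V_ : G -> set V).

(* A_{gh} *)
Definition hom_block (g h : G) : set (V -> V) :=
  [set a | [/\ linear a, forall v, V_ h v -> V_ g (a v) &
               forall k v, k <> h -> V_ k v -> a v = 0]].

Definition gl : set (V -> V) :=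
  lspan [set a | exists i j, hom_block i j a].

Definition gl_ (g : G) : set (V -> V) :=
  lspan [set a | exists i j, i = j + g /\ hom_block i j a].

(* The bilinear extension to gl of [a,b] = ab - r(|b|,|a|) ba, expressed on
   the homogeneous components of a and b. *)
Definition bracket (a b : V -> V) : V -> V :=
  \sum_(g \in [set: G]) \sum_(h \in [set: G])
    (component gl_ a g \o component gl_ b h
     - r h g *: (component gl_ b h \o component gl_ a g)).

Definition brackets (X : set (V -> V)) : set (V -> V) :=
  lspan [set c | exists a b, [/\ X a, X b & c = bracket a b]].

Definition lie_color_subalgebra (L : set (V -> V)) : Prop :=
  [/\ L `<=` gl, graded_subspace gl_ L &
      forall a b, L a -> L b -> L (bracket a b)].

Fixpoint derived (L : set (V -> V)) (k : nat) : set (V -> V) :=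
  if k is k'.+1 then brackets (derived L k') else L.

Definition lie_solvable (L : set (V -> V)) : Prop :=
  exists k, derived L k = [set 0].

Definition nilpotent_end (a : V -> V) : Prop :=
  exists n, forall v, iter n a v = 0.

Definition homogeneous_basis (I : choiceType) (e : I -> V) : Prop :=
  basis e /\ forall i, homogeneous V_ (e i).

Definition initial_segment (d : Order.disp_t) (I : orderType d)
    (D : set I) : Prop :=
  forall i j, D j -> (i <= j)%O -> D i.

Definition flag_of (d : Order.disp_t) (I : orderType d) (e : I -> V) :
    set (set V) :=
  [set W | exists2 D, initial_segment D & W = lspan (e @` D)].

Definition color_flag (fl : set (set V)) : Prop :=
  exists (d : Order.disp_t) (I : orderType d) (e : I -> V),
    homogeneous_basis e /\ fl = flag_of e.

Definition stabilizes (L : set (V -> V)) (fl : set (set V)) : Prop :=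
  forall x W, L x -> fl W -> x @` W `<=` W.

(* The (i, j) entry of the matrix of a is [coordinate e (a (e j)) i]. *)
Definition upper_triangular (d : Order.disp_t) (I : orderType d)
    (e : I -> V) (a : V -> V) : Prop :=
  forall i j, (j < i)%O -> coordinate e (a (e j)) i = 0.

End ColorAlgebra.

(* Main.v *)
Require Import Defs.
From HB Require Import structures.
From mathcomp Require Import all_boot all_order all_algebra all_field.
From mathcomp Require Import all_classical wochoice.

Set Implicit Arguments.
Unset Strict Implicit.
Unset Printing Implicit Defensive.

Import Order.TTheory GRing.Theory.

Local Open Scope classical_set_scope.
Local Open Scope ring_scope.

(**
Each element of [L] is a finite sum of blocks of finite rank, and [L] is spanned
by finitely many elements, so a finite part of a homogeneous basis [e] of [V]
carries the whole action: every [a] in [L] kills the other basis vectors and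
takes its values in the span of that part.  On this block [L] becomes a family
of square matrices graded by the degrees of the basis vectors.

Call a homogeneous element strict if its degree is nonzero or if it is a bracket.
Strict elements are nilpotent: those of nonzero degree because [G] is
torsion-free and only finitely many degrees occur, the brackets by hypothesis.
The bracket of two strict elements is again strict, that is, strict elements are
closed under products of the form [x y - c y x] with a scalar [c].  Jacobson's
theorem on weakly closed sets of nilpotent elements then says that long products
of strict elements vanish ([weakly_closed_nilpotent]).

Hence, for every proper graded invariant subspace [W] of the block, the strict
elements annihilate some nonzero homogeneous vector modulo [W].  In a fixed
degree [g] such vectors form a space that the degree-zero part of [L] preserves;
it acts there by operators that commute modulo [W], since their commutators
are strict (the color commutator of two degree-zero elements is the ordinary
one, as [r 0 0 = 1]).  Over an algebraically closed field they have a common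
eigenvector modulo [W] ([homogeneous_step]).  As elements of nonzero degree are
strict, this vector enlarges [W] to an invariant graded subspace with one more
dimension, and iterating yields a homogeneous triangularizing basis of the block
([graded_triangularization]).

The base change on the block extends by the identity to a linear automorphism
of [V], which carries [e] to a homogeneous basis.  Any total order that lists the
block vectors in the order of the flag makes all matrices upper triangular, as
the other basis vectors are killed and never reached; the spans of initial
segments are then invariant.
*)

(** * Jacobson's theorem on weakly closed sets of nilpotent elements *)

Section WeaklyClosedNilpotent.
Variables (F : fieldType) (A : falgType F).
Implicit Types (K : {vspace A}) (x y : A).

(** The right ideals [K ^+ j * A] form a decreasing chain that ends at [0].  The
relation on [x] and [K] lets [x] move past [K], so each ideal of the chain is
stable under [x].  A product of [m] factors from [K + <[x]>] sends each ideal
into the next one: either it uses an element of [K], or it is a multiple of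
[x ^+ m]. *)
Lemma nil_add_line K x k m : (K ^+ k)%VS = 0%VS -> x ^+ m = 0 ->
  (<[x]> * K <= K * <[x]> + K)%VS -> ((K + <[x]>) ^+ (k * m))%VS = 0%VS.
Proof.
move=> K0 x0 xK; set U := (K + <[x]>)%VS.
pose I j := (K ^+ j * fullv)%VS.
have IS j : (K * I j)%VS = I j.+1 by rewrite /I expvSl prodvA.
have xI j : (<[x]> * I j <= I j)%VS.
  elim: j => [|j IHj]; first by rewrite /I expv0 prod1v subvf.
  rewrite -!IS prodvA (subv_trans (prodvSl _ xK)) // prodvDl -prodvA subv_add.
  by rewrite subvv andbT prodvSr.
have xiI i j : (<[x]> ^+ i * I j <= I j)%VS.
  elim: i => [|i IHi]; first by rewrite expv0 prod1v.
  by rewrite expvSl -prodvA (subv_trans (prodvSr _ IHi)).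
have I_decr j : (I j.+1 <= I j)%VS by rewrite /I expvSr -prodvA prodvSr ?subvf.
have UI i j : (U ^+ i * I j <= <[x]> ^+ i * I j + I j.+1)%VS.
  elim: i => [|i IHi]; first by rewrite !expv0 !prod1v addvSl.
  rewrite expvSl -prodvA (subv_trans (prodvSr _ IHi)) // prodvDl !prodvDr.
  rewrite !subv_add [in X in _ && X]prodvA -expvSl addvSl.
  have KI : (K * (<[x]> ^+ i * I j) <= I j.+1)%VS by rewrite -IS prodvSr.
  have KI' : (K * I j.+1 <= I j.+1)%VS.
    by rewrite IS I_decr.
  have xI' : (<[x]> * I j.+1 <= I j.+1)%VS := xI _.
  by rewrite !(subv_trans _ (addvSr _ _)).
have Um j : (U ^+ m * I j <= I j.+1)%VS.
  by have := UI m j; rewrite expv_line x0 prod0v add0v.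
have Uj j : (U ^+ (j * m) * fullv <= I j)%VS.
  elim: j => [|j IHj]; first by rewrite /I !expv0.
  by rewrite mulSn expvD -prodvA (subv_trans (prodvSr _ IHj)).
apply/eqP; rewrite -subv0 (subv_trans _ (subv_trans (Uj k) _)) //.
  by rewrite -{1}[(U ^+ _)%VS]prodv1 prodvSr ?subvf.
by rewrite /I K0 prod0v.
Qed.

Variables (N : set A).
Hypothesis N_closed :
  forall x y, N x -> N y -> exists c : F, N (x * y - c *: (y * x)).
Hypothesis N_nil : forall x, N x -> exists m, x ^+ m = 0.

(** Starting from [x] in [N] outside the span, replace [x] by a commutator with an
element of [s] as long as the result stays outside.  After [t] replacements
[x] is a combination of words with [t] factors from [s] around it, and these
vanish for large [t]; so the process stops, at an element whose
commutators with [s] all lie in the span of [s]. *)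
Lemma ex_normalizing (s : seq A) k : (<<s>> ^+ k)%VS = 0%VS ->
  (forall y, y \in s -> N y) -> (exists2 x, N x & x \notin <<s>>%VS) ->
  exists x, [/\ N x, x \notin <<s>>%VS &
    (<[x]> * <<s>> <= <<s>> * <[x]> + <<s>>)%VS].
Proof.
move=> s0 Ns [x0 Nx0 x0s]; pose K := <<s>>%VS.
apply: contrapT => none.
have step x : N x -> x \notin K -> exists y c, [/\ y \in K,
    N (x * y - c *: (y * x)) & x * y - c *: (y * x) \notin K].
  move=> Nx xK; apply: contrapT => no; apply: none; exists x; split => //.
  apply/prodvP => u v /vlineP[a ->] vs; rewrite (coord_span (vs : v \in <<in_tuple s>>%VS)).
  rewrite mulr_sumr memv_suml // => i _.
  have sI : s`_i \in s by rewrite mem_nth.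
  have [c Nc] := N_closed Nx (Ns _ sI).
  have Kc : x * s`_i - c *: (s`_i * x) \in K.
    apply/negPn/negP => nK; apply: no; exists s`_i, c; split=> //.
    exact: memv_span.
  rewrite -scalerAl -scalerAr scalerA memvZ //.
  rewrite -[x * _](subrK (c *: (s`_i * x))) addrC memv_add //.
  by rewrite memvZ // memv_mul ?memv_span ?memv_line.
(* Words with t factors in K distributed on both sides of one element of A. *)
pose B t := (\sum_(i < t.+1) K ^+ i * (fullv * K ^+ (t - i)))%VS.
have [T BT]: exists T, B T = 0%VS.
  exists (k + k)%N; rewrite /B big1 // => i _.
  have [ki|ik] := leqP k i.
    by rewrite -(subnKC ki) expvD s0 !prod0v.
  have le: (k <= k + k - i)%N by rewrite -addnBA ?leq_addr // ltnW.
  by rewrite -(subnKC le) expvD s0 !prod0v !prodv0.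
have BK t : (B t * K <= B t.+1)%VS.
  rewrite /B big_distrl /=; apply/subv_sumP => i _.
  apply: (subv_trans _ (sumv_sup (widen_ord (leqnSn _) i) _ (subvv _))) => //=.
  by rewrite subSn ?leq_ord // expvSr !prodvA.
have KB t : (K * B t <= B t.+1)%VS.
  rewrite /B big_distrr /=; apply/subv_sumP => i _.
  apply: (subv_trans _ (sumv_sup (lift ord0 i) _ (subvv _))) => //=.
  by rewrite /bump /= add1n subSS expvSl !prodvA.
have [x [Nx xK xB]] : exists x, [/\ N x, x \notin K & x \in B T].
  elim: (T) => [|t [x [Nx xK xB]]].
    by exists x0; split=> //; rewrite /B big_ord1 /= expv0 prodv1 prod1v memvf.
  have [y [c [yK Nxy xyK]]] := step x Nx xK.
  exists (x * y - c *: (y * x)); split=> //; rewrite memvB ?memvZ //.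
    by apply: subvP (BK t) _ _; rewrite memv_mul.
  by apply: subvP (KB t) _ _; rewrite memv_mul.
by move: xB xK; rewrite BT memv0 => /eqP->; rewrite mem0v.
Qed.

(** Enlarge a nilpotent span of elements of [N] one dimension at a time, until it
contains [N]. *)
Theorem weakly_closed_nilpotent :
  exists (K : {vspace A}) k, (forall x, N x -> x \in K) /\ (K ^+ k)%VS = 0%VS.
Proof.
suff grow t : exists s : seq A, [/\ forall y, y \in s -> N y,
    exists k, (<<s>> ^+ k)%VS = 0%VS &
    (forall x, N x -> x \in <<s>>%VS) \/ (t <= \dim <<s>>)%N].
  have [s [_ [k sk] [Ns|]]] := grow (\dim {:A}).+1; first by exists <<s>>%VS, k.
  by rewrite ltnNge dimvS ?subvf.
elim: t => [|t [s [Ns [k sk] le_t]]].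
  by exists [::]; split=> //; [exists 1%N; rewrite expv1 span_nil | right].
have [Nsub|/existsNP[x0 /not_implyP[Nx0 /negP x0s]]] :=
  pselect (forall x, N x -> x \in <<s>>%VS); first by exists s; split; eauto.
case: le_t => [/(_ _ Nx0)|le_t]; first by rewrite (negPf x0s).
have [|x [Nx xs norm]] := ex_normalizing sk Ns; first by exists x0.
have [m xm] := N_nil Nx.
exists (x :: s); rewrite span_cons addvC; split.
- by move=> y; rewrite inE => /predU1P[->|/Ns].
- by exists (k * m)%N; apply: nil_add_line.
right; rewrite (leq_ltn_trans le_t) // ltnNge; apply: contra xs => le_dim.
have /eqP-> : (<<s>> == <<s>> + <[x]>)%VS by rewrite eqEdim addvSl.
by rewrite (subvP (addvSr _ _)) ?memv_line.
Qed.
End WeaklyClosedNilpotent.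

(** * Subspaces and eigenvectors *)

Lemma submod_closed_vspace (F : fieldType) (vT : vectType F) (S : set vT) :
  S 0 -> (forall a u v, S u -> S v -> S (a *: u + v)) ->
  exists U : {vspace vT}, forall v, v \in U <-> S v.
Proof.
move=> S0 Slin.
pose P d := `[< exists2 U : {vspace vT}, \dim U = d & forall v, v \in U -> S v >].
have P0 : exists d, P d.
  exists 0%N; apply/asboolP; exists 0%VS; first by rewrite dimv0.
  by move=> v; rewrite memv0 => /eqP->.
have Pmax d : P d -> (d <= \dim {:vT})%N.
  by move=> /asboolP[U <- _]; rewrite dimvS ?subvf.
case: (ex_maxnP P0 Pmax) => d /asboolP[U dU US] maxd; exists U => v.
split=> [/US//|Sv]; apply/negPn/negP => vU.
have: P (\dim (U + <[v]>)).
  apply/asboolP; exists (U + <[v]>)%VS => // w /memv_addP[u uU [_ /vlineP[a ->] ->]].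
  by rewrite addrC; apply: Slin => //; apply: US.
move=> /maxd; rewrite -dU => le_dim; apply/negP: vU.
have /eqP-> : (U == U + <[v]>)%VS by rewrite eqEdim addvSl.
by rewrite (subvP (addvSr _ _)) ?memv_line.
Qed.

Lemma closed_field_root (F : fieldType) (closedF : GRing.closed_field_axiom F)
  (p : {poly F}) : (1 < size p)%N -> exists x, root p x.
Proof.
move=> p1; have [m sz_p] : exists m, size p = m.+2 by case: size p1 => [|[|m]]; eauto.
have lc0 : p`_m.+1 != 0.
  by have := lead_coef_eq0 p; rewrite lead_coefE sz_p /= => ->; rewrite -size_poly_eq0 sz_p.
have [x xE] := closedF m.+1 (fun i => - p`_i / p`_m.+1) isT.
exists x; rewrite /root horner_coef sz_p big_ord_recr /= xE mulr_sumr -big_split /=.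
rewrite big1 // => i _.
by rewrite mulrA mulrCA divff // mulr1 mulNr subrr.
Qed.

(** * Triangularization of graded families of matrices *)

Section GradedMatrices.
Variables (F : fieldType) (closedF : GRing.closed_field_axiom F).
Variables (G : zmodType) (G_tf : torsion_free G) (n' : nat).
Local Notation n := n'.+1.
Variables (deg : 'I_n -> G) (c : G -> G -> F) (H : G -> set 'M[F]_n).
Hypothesis c00 : c 0 0 = 1.
Hypothesis H_deg : forall g X, H g X ->
  forall i j, X i j != 0 -> deg i = deg j + g.
Hypothesis H_bracket : forall g h X Y, H g X -> H h Y ->
  H (g + h) (X * Y - c g h *: (Y * X)).
Hypothesis H_bracket_nil : forall g h X Y, H g X -> H h Y ->
  exists m, (X * Y - c g h *: (Y * X)) ^+ m = 0.

(** An eigenvector in the quotient of [M] by [W], phrased without the quotient: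
divide linear factors out of a polynomial that sends [v] into [W], starting from
the characteristic polynomial. *)
Lemma relative_eigenvector (X : 'M[F]_n) (M W : {vspace 'cV[F]_n}) v :
  (forall u, u \in M -> X *m u \in M) -> v \in M -> v \notin W ->
  exists a u, [/\ u \in M, u \notin W & X *m u - a *: u \in W].
Proof.
move=> XM vM vW.
have pM (p : {poly F}) : horner_mx X p *m v \in M.
  elim/poly_ind: p => [|p a IHp]; first by rewrite rmorph0 mul0mx mem0v.
  rewrite rmorphD rmorphM /= horner_mx_X horner_mx_C mulmxDl.
  rewrite -mulmxE (comm_horner_mx _ (comm_mx_refl X)) -mulmxA mul_scalar_mx.
  by rewrite memvD ?memvZ // XM.
suff rec d (p : {poly F}) : (size p <= d)%N -> p != 0 -> horner_mx X p *m v \in W ->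
    exists a u, [/\ u \in M, u \notin W & X *m u - a *: u \in W].
  apply: (rec _ (char_poly X) (leqnn _)).
    by rewrite monic_neq0 ?char_poly_monic.
  by rewrite Cayley_Hamilton mul0mx mem0v.
elim: d p => [|d IHd] p; first by rewrite leqn0 size_poly_eq0 => ->.
move=> le_p p0 pW; have [lt1p|] := ltnP 1 (size p); last first.
  move=> /size1_polyC pE; case/negP: vW; move: pW p0; rewrite pE horner_mx_C.
  rewrite mul_scalar_mx polyC_eq0 => aW a0.
  by rewrite -[v](scalerK a0) memvZ.
have [a /factor_theorem[q qE]] := closed_field_root closedF lt1p.
have q0 : q != 0 by apply: contraNneq p0 => q0; rewrite qE q0 mul0r.
have [qW|qW] := boolP (horner_mx X q *m v \in W).
  by apply: (IHd q) => //; move: le_p; rewrite qE size_Mmonic ?monicXsubC // size_XsubC addn2.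
exists a, (horner_mx X q *m v); split=> //.
move: pW; rewrite qE rmorphM rmorphB /= horner_mx_X horner_mx_C.
have -> : horner_mx X q * (X - a%:M) = (X - a%:M) * horner_mx X q.
  by rewrite mulrBr mulrBl -!mulmxE scalar_mxC (comm_horner_mx _ (comm_mx_refl X)).
by rewrite -mulmxE -mulmxA mulmxBl mul_scalar_mx.
Qed.

Definition strict_part : set 'M[F]_n := [set X | (exists2 g, g != 0 & H g X) \/
  exists g h Y Z, [/\ H g Y, H h Z & X = Y * Z - c g h *: (Z * Y)]].

Lemma exp_deg g X m i j : H g X -> (X ^+ m) i j != 0 -> deg i = deg j + g *+ m.
Proof.
move=> HX; elim: m i j => [|m IHm] i j.
  by rewrite expr0 mxE mulr0n addr0; case: (i =P j) => [->|]; rewrite ?eqxx.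
rewrite exprS -mulmxE mxE => /eqP XXm.
have [k Xk] : exists k, X i k * (X ^+ m) k j != 0.
  apply: contrapT => /forallNP X0; apply: XXm; rewrite big1 // => k _.
  exact/eqP/negPn/negP/X0.
move: Xk; rewrite mulf_eq0 negb_or => /andP[/(H_deg HX)-> /IHm->].
by rewrite mulrSr addrA.
Qed.

(** A nonzero entry of [X ^+ m] forces two of the finitely many degrees to differ
by [g *+ m]; since [G] is torsion-free, a given pair of positions serves at most
one exponent [m]. *)
Lemma nonzero_deg_nilpotent g X : g != 0 -> H g X -> exists m, X ^+ m = 0.
Proof.
move=> g0 HX; apply: contrapT => /forallNP Xn0.
have ent m : exists ij : 'I_n * 'I_n, (X ^+ m) ij.1 ij.2 != 0.
  apply: contrapT => /forallNP X0; apply: (Xn0 m); apply/matrixP => i j.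
  by rewrite [RHS]mxE; apply/eqP/negPn/negP => nz; apply: (X0 (i, j)).
pose f m := projT1 (cid (ent m)).
have f_inj m1 m2 : (m1 <= m2)%N -> f m1 = f m2 -> m1 = m2.
  move=> le12 f12.
  have := exp_deg HX (projT2 (cid (ent m1))); rewrite -/(f m1) f12.
  rewrite (exp_deg HX (projT2 (cid (ent m2)))) -/(f m2) => /addrI /eqP.
  rewrite -subr_eq0 -mulrnBr // => /eqP gm.
  apply/eqP; rewrite eqn_leq le12 /= -subn_eq0 -leqn0 leqNgt.
  by apply/negP => /G_tf /(_ gm) /eqP; apply/negP.
have inj : injective (fun m : 'I_(n * n).+1 => f m).
  move=> m1 m2 f12; apply: val_inj => /=.
  by have [le|/ltnW le] := leqP m1 m2; [|apply/esym]; apply: f_inj.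
have := leq_card _ inj; rewrite card_ord card_prod card_ord ltnn.
by [].
Qed.

Lemma strict_part_bracket g h X Y : H g X -> H h Y ->
  strict_part (X * Y - c g h *: (Y * X)).
Proof. by move=> HX HY; right; exists g, h, X, Y. Qed.

Lemma strict_part_homogeneous X : strict_part X -> exists g, H g X.
Proof.
case=> [[g _ HX]|[g [h [Y [Z [HY HZ ->]]]]]]; first by exists g.
by exists (g + h); apply: H_bracket.
Qed.

Lemma strict_part_nil_space : exists (K : {vspace 'M[F]_n}) k,
  (forall X, strict_part X -> X \in K) /\ (K ^+ k)%VS = 0%VS.
Proof.
apply: weakly_closed_nilpotent => [X Y|X].
  move=> /strict_part_homogeneous[g HX] /strict_part_homogeneous[h HY].
  by exists (c g h); apply: strict_part_bracket.
case=> [[g g0 HX]|[g [h [Y [Z [HY HZ ->]]]]]]; first exact: nonzero_deg_nilpotent HX.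
exact: H_bracket_nil.
Qed.

Definition of_degree g (v : 'cV[F]_n) := forall i, v i 0 != 0 -> deg i = g.

Definition deg_part g (v : 'cV[F]_n) : 'cV[F]_n :=
  \col_i (if deg i == g then v i 0 else 0).

Lemma deg_partP g v : of_degree g (deg_part g v).
Proof. by move=> i; rewrite mxE; case: (deg i =P g) => // _; rewrite eqxx. Qed.

Lemma mul_deg_part g h X v : H h X ->
  X *m deg_part g v = deg_part (g + h) (X *m v).
Proof.
move=> HX; apply/colP => i; rewrite !mxE.
case: (deg i =P g + h) => [di|di]; last rewrite big1 //; [apply: eq_bigr|] => j _;
  rewrite mxE; have [->|/(H_deg HX) dij] := eqVneq (X i j) 0; rewrite ?mul0r //;
  case: (deg j =P g) => // dj; rewrite ?mulr0 //.
  by case: dj; apply: (@addIr _ h); rewrite -dij.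
by case: di; rewrite dij dj.
Qed.

Lemma deg_part_id g v : of_degree g v -> deg_part g v = v.
Proof.
move=> vg; apply/colP => i; rewrite mxE; have [->|/vg->] := eqVneq (v i 0) 0.
  by rewrite if_same.
by rewrite eqxx.
Qed.

Lemma deg_part_other g h v : of_degree g v -> g != h -> deg_part h v = 0.
Proof.
move=> vg gh; apply/colP => i; rewrite !mxE; have [->|/vg->] := eqVneq (v i 0) 0.
  by rewrite if_same.
by rewrite (negPf gh).
Qed.

(** The degree components of a vector sum up to it, over the degrees that occur. *)
Lemma deg_part_mem (W : {vspace 'cV[F]_n}) v :
  (forall g, deg_part g v \in W) -> v \in W.
Proof.
move=> vW; suff -> : v = \sum_(g <- undup [seq deg i | i : 'I_n]) deg_part g v.
  by rewrite memv_suml.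
apply/colP => i; rewrite summxE.
rewrite (bigD1_seq (deg i)) ?undup_uniq ?mem_undup ?codom_f //=.
rewrite big1 ?addr0 => [|g gi]; rewrite mxE ?eqxx //.
by rewrite eq_sym (negPf gi).
Qed.

(** The one-dimensional step of the flag.  A nilpotent span of the strict elements
gives a homogeneous vector outside [W] that they all send into [W].  The space [M]
of such vectors of the same degree is invariant under degree-zero elements; if
one of these is not scalar modulo [W] on [M], its eigenspace modulo [W] is a
smaller invariant space, so a common eigenvector is reached by induction on the
dimension. *)
Lemma homogeneous_step (W : {vspace 'cV[F]_n}) :
  (forall g X v, H g X -> v \in W -> X *m v \in W) ->
  (forall g v, v \in W -> deg_part g v \in W) -> W != fullv ->
  exists g v, [/\ of_degree g v, v \notin W &
    forall h X, H h X -> X *m v \in (W + <[v]>)%VS].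
Proof.
move=> HW gradW Wproper.
have [K [k [NK K0]]] := strict_part_nil_space.
have [v0 v0W] : exists v0, v0 \notin W.
  apply: contrapT => /forallNP full; case/negP: Wproper; rewrite eqEsubv subvf /=.
  by apply/subvP => v _; apply/negPn/negP/full.
(* Apply elements of K to v0 as long as the result leaves W. *)
have [u0 u0W Nu0] : exists2 u, u \notin W & forall X, strict_part X -> X *m u \in W.
  suff rec t v : v \notin W -> (forall X, X \in (K ^+ t)%VS -> X *m v \in W) ->
      exists2 u, u \notin W & forall X, strict_part X -> X *m u \in W.
    by apply: (rec k v0) => // X; rewrite K0 memv0 => /eqP->; rewrite mul0mx mem0v.
  elim: t v => [|t IHt] v vW Kv.
    by case/negP: vW; rewrite -[v]mul1mx Kv // expv0 memv_line.
  have [NW|/existsNP[X /not_implyP[/NK XK /negP XW]]] :=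
    pselect (forall X, strict_part X -> X *m v \in W); first by exists v.
  apply: (IHt _ XW) => Y YK; rewrite mulmxA Kv // expvSr; exact: memv_mul.
(* Some degree component of u0 is outside W, and strict elements send it to a
   degree component of an element of W. *)
have [g [u [ug uW Nu]]] : exists g u, [/\ of_degree g u, u \notin W &
    forall X, strict_part X -> X *m u \in W].
  have [g gW] : exists g, deg_part g u0 \notin W.
    apply: contrapT => /forallNP full; case/negP: u0W; apply: deg_part_mem => g.
    by apply/negPn/negP/full.
  exists g, (deg_part g u0); split=> // [|X NX]; first exact: deg_partP.
  by have [h HX] := strict_part_homogeneous NX; rewrite (mul_deg_part _ _ HX) gradW ?Nu0.
exists g.
suff rec d (M : {vspace 'cV[F]_n}) : (\dim M <= d)%N ->
    (forall v, v \in M -> of_degree g v) ->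
    (forall X v, strict_part X -> v \in M -> X *m v \in W) ->
    (forall X v, H 0 X -> v \in M -> X *m v \in M) ->
    (exists2 v, v \in M & v \notin W) ->
    exists v, [/\ of_degree g v, v \notin W &
      forall h X, H h X -> X *m v \in (W + <[v]>)%VS].
  have [||M MP] := @submod_closed_vspace F 'cV[F]_n
    [set v | of_degree g v /\ forall X, strict_part X -> X *m v \in W].
  - by split=> [i|X _]; rewrite ?mxE ?eqxx // mulmx0 mem0v.
  - move=> a v w [vg Nv] [wg Nw]; split=> [i|X NX]; last first.
      by rewrite mulmxDr -scalemxAr memvD ?memvZ ?Nv ?Nw.
    rewrite !mxE; have [vi|/vg//] := eqVneq (v i 0) 0.
    by rewrite vi mulr0 add0r => /wg.
  apply: (rec _ M (leqnn _)).
  - by move=> v /MP[].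
  - by move=> X v NX /MP[_]; apply.
  - move=> X v HX /MP[vg Nv]; apply/MP; split.
      have := mul_deg_part g v HX; rewrite (deg_part_id vg) addr0 => ->.
      exact: deg_partP.
    move=> Y NY; have [h HY] := strict_part_homogeneous NY.
    have -> : Y *m (X *m v) = (Y * X - c h 0 *: (X * Y)) *m v + c h 0 *: (X *m (Y *m v)).
      by rewrite mulmxBl -scalemxAl -!mulmxE -!mulmxA subrK.
    rewrite memvD ?Nv ?memvZ //; first exact: strict_part_bracket.
    by apply: HW HX _; apply: Nv.
  - by exists u => //; apply/MP.
elim: d M => [|d IHd] M le_M Mg NM HM [v vM vW].
  move: le_M vW; rewrite leqn0 dimv_eq0 => /eqP M0.
  by move: vM; rewrite M0 memv0 => /eqP->; rewrite mem0v.
have [scal|] := pselect (forall X v, H 0 X -> v \in M -> X *m v \in (W + <[v]>)%VS).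
  exists v; split=> // [|h X HX]; first exact: Mg.
  have [h0|h0] := eqVneq h 0; first by apply: scal => //; rewrite -h0.
  by apply: (subvP (addvSl _ _)); apply: NM => //; left; exists h.
move=> /existsNP[X /existsNP[w /not_implyP[HX /not_implyP[wM /negP Xw]]]].
have [a [z [zM zW Xz]]] := relative_eigenvector (HM _ ^~ HX) vM vW.
have [||M' M'P] := @submod_closed_vspace F 'cV[F]_n
  [set v | v \in M /\ X *m v - a *: v \in W].
- by rewrite /= mem0v mulmx0 scaler0 subr0 mem0v.
- move=> b v1 v2 [v1M Xv1] [v2M Xv2]; split; first by rewrite memvD ?memvZ.
  have -> : X *m (b *: v1 + v2) - a *: (b *: v1 + v2) =
      b *: (X *m v1 - a *: v1) + (X *m v2 - a *: v2).
    rewrite mulmxDr -scalemxAr scalerDr scalerBr !scalerA [b * a]mulrC.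
    by rewrite opprD addrACA.
  by rewrite memvD ?memvZ.
apply: (IHd M').
- rewrite -ltnS (leq_trans _ le_M) // ltnNge; apply: contra Xw => le_dim.
  have M'M : (M' <= M)%VS by apply/subvP => x /M'P[].
  have /eqP M'E : M' == M by rewrite eqEdim M'M.
  move: wM; rewrite -M'E => /M'P[_ Xw].
  by rewrite -[X *m w](subrK (a *: w)) memv_add // memvZ ?memv_line.
- by move=> x /M'P[/Mg].
- by move=> Y x NY /M'P[xM _]; apply: NM.
- move=> Y x HY /M'P[xM Xx]; apply/M'P; split; first exact: HM.
  have -> : X *m (Y *m x) - a *: (Y *m x) =
      (X * Y - c 0 0 *: (Y * X)) *m x + Y *m (X *m x - a *: x).
    rewrite c00 scale1r mulmxBl mulmxBr -!mulmxE -!mulmxA -scalemxAr addrA subrK //.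
  rewrite memvD //; last exact: HW HY _.
  by apply: NM => //; apply: strict_part_bracket.
- by exists z => //; apply/M'P.
Qed.

(** The list grows at its head, so the members of the flag are the spans of its
suffixes.  This is why the triangular form obtained below is lower triangular. *)
Fixpoint homogeneous_flag (s : seq 'cV[F]_n) : Prop :=
  if s is v :: s' then
    [/\ homogeneous_flag s', exists g, of_degree g v, v \notin <<s'>>%VS &
        forall h X, H h X -> X *m v \in <<s>>%VS]
  else True.

Lemma homogeneous_flag_stable s : homogeneous_flag s ->
  (forall g X v, H g X -> v \in <<s>>%VS -> X *m v \in <<s>>%VS) /\
  (forall g v, v \in <<s>>%VS -> deg_part g v \in <<s>>%VS).
Proof.
elim: s => [|v s IHs] /=.
  move=> _; rewrite span_nil; split=> [g X v _|g v]; rewrite !memv0 => /eqP->.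
    by rewrite mulmx0.
  by apply/eqP/colP => i; rewrite !mxE if_same.
move=> [/IHs[Hs gs] [g0 vg] _ Hv].
have sub : (<<s>> <= <<v :: s>>)%VS by rewrite span_cons addvSr.
split=> [g X w HX|g w]; rewrite {1}span_cons => /memv_addP[_ /vlineP[a ->] [y ys ->]].
  by rewrite mulmxDr -scalemxAr memvD ?memvZ ?(Hv _ _ HX) // (subvP sub) ?(Hs _ _ _ HX).
have -> : deg_part g (a *: v + y) = a *: deg_part g v + deg_part g y.
  by apply/colP => i; rewrite !mxE; case: ifP; rewrite ?mulr0 ?addr0.
rewrite memvD ?(subvP sub _ (gs _ _ ys)) // memvZ //.
have [<-|gg] := eqVneq g0 g; first by rewrite deg_part_id // memv_span ?mem_head.
by rewrite (deg_part_other vg gg) mem0v.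
Qed.

Lemma homogeneous_flag_free s : homogeneous_flag s -> free s.
Proof.
elim: s => [|v s IHs] /=; first by rewrite nil_free.
by case=> /IHs; rewrite free_cons => -> _ ->.
Qed.

Lemma full_homogeneous_flag : exists2 s, homogeneous_flag s & basis_of fullv s.
Proof.
suff rec d : exists2 s, homogeneous_flag s & <<s>>%VS = fullv \/ (d <= \dim <<s>>)%N.
  have [s sF [sE|]] := rec (\dim {:'cV[F]_n}).+1.
    by exists s => //; rewrite basisEfree homogeneous_flag_free // sE subvv -sE;
      have /eqP-> := homogeneous_flag_free sF; rewrite leqnn.
  by rewrite ltnNge dimvS ?subvf.
elim: d => [|d [s sF [sE|led]]]; [by exists [::]; [|right]|by exists s; [|left]|].
have [full|proper] := eqVneq <<s>>%VS fullv; first by exists s; [|left].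
have [Hs gs] := homogeneous_flag_stable sF.
have [g [v [vg vs Hv]]] := homogeneous_step Hs gs proper.
have vsF : homogeneous_flag (v :: s).
  by split=> //; [exists g|move=> h X HX; rewrite span_cons addvC (Hv h)].
exists (v :: s) => //; right.
have /eqP-> := homogeneous_flag_free vsF; rewrite ltnS.
by rewrite (leq_trans led) ?dim_span.
Qed.

Lemma homogeneous_flag_nth s k : homogeneous_flag s -> (k < size s)%N ->
  (exists g, of_degree g s`_k) /\
  forall h X, H h X -> X *m s`_k \in <<drop k s>>%VS.
Proof.
elim: s k => // v s IHs [|k] /= [sF [g vg] _ Hv] lt_k; last exact: IHs.
by split; [exists g|].
Qed.

End GradedMatrices.

Lemma coord_drop (F : fieldType) (vT : vectType F) m (t : m.-tuple vT) k (l : 'I_m) v :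
  free t -> v \in <<drop k t>>%VS -> (l < k)%N -> coord t l v = 0.
Proof.
move=> t_free vt lk; rewrite (coord_span (vt : v \in <<in_tuple (drop k t)>>%VS)).
rewrite linear_sum big1 // => j _; rewrite linearZ /= nth_drop.
have ltm : (k + j < m)%N.
  by rewrite -ltn_subRL -{2}(size_tuple t) -size_drop.
rewrite -[(k + j)%N]/(val (Ordinal ltm)) coord_free // -val_eqE /=.
by rewrite gtn_eqF ?mulr0 // (leq_trans lk) ?leq_addr.
Qed.

(** The columns of [P] are the vectors of a full homogeneous flag and [Q] computes
coordinates in that basis. *)
Theorem graded_triangularization (F : fieldType)
    (closedF : GRing.closed_field_axiom F) (G : zmodType) (G_tf : torsion_free G)
    n (deg : 'I_n -> G) (c : G -> G -> F) (H : G -> set 'M[F]_n) :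
  c 0 0 = 1 ->
  (forall g X, H g X -> forall i j, X i j != 0 -> deg i = deg j + g) ->
  (forall g h X Y, H g X -> H h Y ->
     H (g + h) (X *m Y - c g h *: (Y *m X))) ->
  (forall g h X Y, H g X -> H h Y -> exists m,
     iter m (mulmx (X *m Y - c g h *: (Y *m X))) 1%:M = 0) ->
  exists P Q : 'M[F]_n, [/\ Q *m P = 1%:M,
    forall k, exists g, forall l, P l k != 0 -> deg l = g &
    forall g X, H g X -> forall l k : 'I_n, (l < k)%N -> (Q *m (X *m P)) l k = 0].
Proof.
case: n deg H => [|n'] deg H c00 H_deg H_br H_nil.
  exists 1%:M, 1%:M; split=> [|[]//|g X _ []//]; exact: mul1mx.
have H_nil' g h X Y : H g X -> H h Y -> exists m, (X * Y - c g h *: (Y * X)) ^+ m = 0.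
  move=> HX HY; have [m] := H_nil g h X Y HX HY; exists m; rewrite -[LHS]mulr1.
  by rewrite -iter_mulr -mulmxE.
have [s sF s_basis] := full_homogeneous_flag closedF G_tf c00 H_deg H_br H_nil'.
have sz_s : size s == n'.+1.
  rewrite -(eqP (basis_free s_basis)) (span_basis s_basis) dimvf.
  exact/eqP/muln1.
pose t := Tuple sz_s.
pose P : 'M[F]_n'.+1 := \matrix_(l, k) s`_k l 0.
pose Q : 'M[F]_n'.+1 := \matrix_(l, i) coord t l (delta_mx i 0).
have colP k : col k P = s`_k by apply/matrixP => i j; rewrite !mxE ord1.
have QE (Y : 'M[F]_n'.+1) l k : (Q *m Y) l k = coord t l (col k Y).
  rewrite mxE [in RHS](matrix_sum_delta (col k Y)) linear_sum; apply: eq_bigr => i _.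
  by rewrite big_ord1 linearZ /= !mxE mulrC.
exists P, Q; split=> [|k|g X HX l k lk].
- apply/matrixP => l k; rewrite QE colP mxE.
  by rewrite (coord_free k l (basis_free (s_basis : basis_of _ t))) eq_sym.
- have [|[g vg] _] := homogeneous_flag_nth (k := k) sF; first by rewrite (eqP sz_s).
  by exists g => l; rewrite mxE => /vg.
have [|_ /(_ _ _ HX) Xk] := homogeneous_flag_nth (k := k) sF; first by rewrite (eqP sz_s).
rewrite QE; apply: coord_drop lk; first exact: basis_free s_basis.
suff -> : col k (X *m P) = X *m s`_k by [].
by rewrite -colP !colE mulmxA.
Qed.

(** * Finitely supported sums, spans and bases *)

Lemma fsum_seq (M : nmodType) (I : choiceType) (f : I -> M) (r : seq I) :
  uniq r -> (forall i, i \notin r -> f i = 0) ->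
  \sum_(i \in [set: I]) f i = \sum_(i <- r) f i.
Proof.
move=> r_uniq f0; rewrite [RHS]fsbig_seq //; apply/esym/fsbig_widen => // i /= [_].
by move/negP/f0.
Qed.

Lemma finite_supp_seq (M : nmodType) (I : choiceType) (f : I -> M) :
  finite_set [set i | f i != 0] ->
  exists2 r : seq I, uniq r & forall i, i \notin r -> f i = 0.
Proof.
move=> /finite_seqP[r rE]; exists (undup r) => [|i]; first exact: undup_uniq.
rewrite mem_undup => ir; apply/eqP/negPn/negP => fi.
have : [set i | f i != 0] i by [].
by rewrite rE /= (negPf ir).
Qed.

Lemma seq_finite_supp (M : nmodType) (I : choiceType) (f : I -> M) (r : seq I) :
  (forall i, i \notin r -> f i = 0) -> finite_set [set i | f i != 0].
Proof.
move=> f0; apply: (@sub_finite_set _ _ [set` r]); last exact: finite_seq.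
by move=> i /= fi; apply/negPn/negP => /f0 fi0; rewrite fi0 eqxx in fi.
Qed.

(** Gives access to the theory of bundled linear maps for a function that is only
known to satisfy the linearity equation. *)
Lemma exists_linear (F : fieldType) (U W : lmodType F) (a : U -> W) :
  linear a -> exists f : {linear U -> W}, a = f.
Proof.
move=> a_lin.
pose f : {linear U -> W} := HB.pack a (GRing.isLinear.Build F U W *:%R a a_lin).
by exists f.
Qed.

Section Span.
Variables (F : fieldType) (W : lmodType F).
Implicit Types (S T : set W) (u v w : W).

Definition lin_closed T := T 0 /\ forall a u v, T u -> T v -> T (a *: u + v).

Lemma subspaceP T : is_subspace T <-> lin_closed T.
Proof.
rewrite /is_subspace /lin_closed; split=> [[T0 Tl]|[T0 Tl]]; split.
- by have := T0; rewrite inE.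
- by move=> a u v Tu Tv; have := Tl a u v; rewrite !inE; apply.
- by rewrite inE.
- by move=> a u v; rewrite !inE; apply: Tl.
Qed.

Lemma lin_closed_sum T (I : Type) (r : seq I) (P : pred I) (f : I -> W) :
  lin_closed T -> (forall i, P i -> T (f i)) -> T (\sum_(i <- r | P i) f i).
Proof.
move=> [T0 Tl] Tf; elim/big_rec: _ => // i v Pi Tv.
by rewrite -[f i]scale1r; apply: Tl; [apply: Tf|].
Qed.

Lemma lin_closedZ T a v : lin_closed T -> T v -> T (a *: v).
Proof. by move=> [T0 Tl] Tv; rewrite -[_ *: _]addr0; apply: Tl. Qed.

Lemma lspan_min S T : lin_closed T -> S `<=` T -> lspan S `<=` T.
Proof.
move=> Tl ST w [n [c [s [Ss ->]]]]; apply: lin_closed_sum => // i _.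
by apply: lin_closedZ => //; apply: ST.
Qed.

Lemma mem_lspan S w : S w -> lspan S w.
Proof.
by move=> Sw; exists 1%N, (fun=> 1), (fun=> w); split=> //; rewrite big_ord1 scale1r.
Qed.

Lemma lspan_closed S : lin_closed (lspan S).
Proof.
split=> [|a u v [n [c [s [Ss ->]]]] [m [d [t [St ->]]]]].
  by exists 0%N, (fun=> 0), (fun=> 0); split=> [[]//|]; rewrite big_ord0.
pose sel (A : Type) (x : 'I_n -> A) (y : 'I_m -> A) (i : 'I_(n + m)) :=
  match fintype.split i with inl j => x j | inr j => y j end.
exists (n + m)%N, (sel F (fun j => a * c j) d), (sel W s t); split=> [i|].
  by rewrite /sel; case: (fintype.split i).
rewrite big_split_ord scaler_sumr; congr (_ + _); apply: eq_bigr => j _.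
  by rewrite /sel (unsplitK (inl _ j)) scalerA.
by rewrite /sel (unsplitK (inr _ j)).
Qed.

(** A generating family of least size is free: a nontrivial relation would express
one generator by the others. *)
Lemma fin_dim_free S : fin_dim S -> exists n (s : 'I_n -> W),
  S = lspan (range s) /\
  forall c : 'I_n -> F, \sum_i c i *: s i = 0 -> forall i, c i = 0.
Proof.
move=> S_fin; pose P n := `[< exists s : 'I_n -> W, S = lspan (range s) >].
have P_ex : exists n, P n by have [n [s Ss]] := S_fin; exists n; apply/asboolP; exists s.
case: (ex_minnP P_ex) => n /asboolP[s Ss] min_n; exists n, s; split=> // c c0 k.
apply/eqP/negPn/negP => ck.
case: n s Ss min_n c c0 k ck => [|n] s Ss min_n c c0 k ck; first by case: k ck.
have /min_n : P n.
  apply/asboolP; exists (s \o lift k); rewrite Ss; apply/seteqP; split.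
    apply: (lspan_min (lspan_closed _)) => _ [i _ <-].
    case: (unliftP k i) => [j ->|->]; first by apply: mem_lspan; exists j.
    have -> : s k = - (c k)^-1 *: (\sum_(j < n) c (lift k j) *: s (lift k j)).
      apply: (scalerI ck); rewrite scalerA mulrN divff // scaleN1r.
      by apply/eqP; rewrite -addr_eq0; move/eqP: c0; rewrite (bigD1_ord k isT).
    apply: lin_closedZ; first exact: lspan_closed.
    apply: (lin_closed_sum _ (lspan_closed _)) => j _; apply: lin_closedZ.
      exact: lspan_closed.
    by apply: mem_lspan; exists j.
  apply: (lspan_min (lspan_closed _)) => _ [j _ <-]; apply: mem_lspan.
  by exists (lift k j).
by rewrite ltnn.
Qed.

End Span.

Section Coordinates.
Variables (F : fieldType) (W : lmodType F) (I : choiceType) (e : I -> W).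
Implicit Types (w : W).

Lemma coordinates_seq w (c : I -> F) (r : seq I) : uniq r ->
  (forall i, i \notin r -> c i = 0) ->
  coordinates e w c <-> w = \sum_(i <- r) c i *: e i.
Proof.
move=> r_uniq c0; rewrite /coordinates (fsum_seq r_uniq) => [|i /c0->].
  by split=> [[]//|->]; split=> //; apply: seq_finite_supp c0.
by rewrite scale0r.
Qed.

Lemma coordinates_lin a u v (c d : I -> F) : coordinates e u c ->
  coordinates e v d -> coordinates e (a *: u + v) (fun i => a * c i + d i).
Proof.
move=> [] /finite_supp_seq[r _ rc] uE [] /finite_supp_seq[t _ td] vE.
pose q := undup (r ++ t); have q_uniq : uniq q := undup_uniq _.
have qc i : i \notin q -> c i = 0.
  by rewrite mem_undup mem_cat negb_or => /andP[/rc].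
have qd i : i \notin q -> d i = 0.
  by rewrite mem_undup mem_cat negb_or => /andP[_ /td].
apply/(coordinates_seq _ q_uniq) => [i iq|]; first by rewrite qc // qd // mulr0 addr0.
rewrite uE vE !(fsum_seq q_uniq) => [|i /qd->|i /qc->]; rewrite ?scale0r //.
rewrite scaler_sumr -big_split; apply: eq_bigr => i _ /=.
by rewrite scalerA scalerDl.
Qed.

Lemma coordinates0 : coordinates e 0 (fun=> 0).
Proof. by apply/(@coordinates_seq _ _ [::]); rewrite ?big_nil. Qed.

Lemma coordinates_basis i : coordinates e (e i) (fun k => (k == i)%:R).
Proof.
apply/(@coordinates_seq _ _ [:: i]) => //; last by rewrite big_seq1 eqxx scale1r.
by move=> k; rewrite inE => /negPf->.
Qed.

Lemma lspan_coordinates w : lspan (range e) w -> exists c, coordinates e w c.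
Proof.
apply: (@lspan_min _ _ _ [set w | exists c, coordinates e w c]).
  split=> [|a u v [c uc] [d vd]]; first by exists (fun=> 0); apply: coordinates0.
  by exists (fun i => a * c i + d i); apply: coordinates_lin.
by move=> _ [i _ <-]; exists (fun k => (k == i)%:R); apply: coordinates_basis.
Qed.

Lemma basis_intro : (forall w, lspan (range e) w) ->
  (forall c, coordinates e 0 c -> forall i, c i = 0) -> basis e.
Proof.
move=> e_span e_free w; have [c wc] := lspan_coordinates (e_span w).
exists c; split=> // d wd; apply/funext => i; apply/eqP; rewrite -subr_eq0.
apply/eqP; have := coordinates_lin (-1) wd wc; rewrite scaleN1r addNr.
by move=> /e_free/(_ i); rewrite mulN1r addrC.
Qed.

Hypothesis e_basis : basis e.

Lemma coordinateP w : coordinates e w (coordinate e w).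
Proof. by apply: xgetPex; have [c [wc _]] := e_basis w; exists c. Qed.

Lemma coordinateE w c : coordinates e w c -> coordinate e w = c.
Proof.
move=> wc; have [d [_ d_uniq]] := e_basis w.
by rewrite -(d_uniq _ wc) -(d_uniq _ (coordinateP w)).
Qed.

Lemma coordinate_lin a u v i :
  coordinate e (a *: u + v) i = a * coordinate e u i + coordinate e v i.
Proof. by rewrite (coordinateE (coordinates_lin a (coordinateP u) (coordinateP v))). Qed.

Lemma coordinate0 i : coordinate e 0 i = 0.
Proof. by rewrite (coordinateE coordinates0). Qed.

Lemma coordinate_basis i k : coordinate e (e i) k = (k == i)%:R.
Proof. by rewrite (coordinateE (coordinates_basis i)). Qed.

Lemma coordinate_sum (r : seq I) w : uniq r ->
  (forall i, i \notin r -> coordinate e w i = 0) ->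
  w = \sum_(i <- r) coordinate e w i *: e i.
Proof. by move=> r_uniq w0; apply/(coordinates_seq _ r_uniq w0); exact: coordinateP. Qed.

Lemma basis_span w : exists2 r : seq I, uniq r & w = \sum_(i <- r) coordinate e w i *: e i.
Proof.
have [/finite_supp_seq[r r_uniq r0] _] := coordinateP w.
by exists r => //; apply: coordinate_sum.
Qed.

Lemma linear_basis_ext (U : lmodType F) (a b : W -> U) : linear a -> linear b ->
  (forall i, a (e i) = b (e i)) -> a =1 b.
Proof.
move=> /exists_linear[{}a ->] /exists_linear[{}b ->] ab w.
have [r _ ->] := basis_span w; rewrite !linear_sum; apply: eq_bigr => i _.
by rewrite !linearZ ab.
Qed.

(** A vector has the same coordinates along [T \o e] as its inverse image under [T]
has along [e]. *)
Lemma basis_automorphism (T T' : W -> W) : linear T -> linear T' ->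
  cancel T T' -> cancel T' T ->
  basis (T \o e) /\ forall w, coordinate (T \o e) w = coordinate e (T' w).
Proof.
move=> /exists_linear[{}T ->] /exists_linear[{}T' ->] TK T'K.
have equiv w c : coordinates (T \o e) w c <-> coordinates e (T' w) c.
  split=> -[c_fin wE]; split=> //; have [r r_uniq r0] := finite_supp_seq c_fin.
    rewrite wE !(fsum_seq r_uniq) => [|i /r0->|i /r0->]; rewrite ?scale0r //.
    by rewrite linear_sum; apply: eq_bigr => i _; rewrite linearZ /= TK.
  rewrite -[w]T'K wE !(fsum_seq r_uniq) => [|i /r0->|i /r0->]; rewrite ?scale0r //.
  by rewrite linear_sum; apply: eq_bigr => i _; rewrite linearZ.
have Te_basis : basis (T \o e).
  move=> w; have [c [wc c_uniq]] := e_basis (T' w).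
  by exists c; split=> [|d /equiv/c_uniq//]; apply/equiv.
split=> // w; apply/esym/coordinateE/equiv; apply: xgetPex.
by have [c [wc _]] := Te_basis w; exists c.
Qed.

End Coordinates.

(** * A homogeneous basis of a graded space *)

(** Put together bases of all the [V_ g], indexed by a sigma type over [G].  A
relation between finitely many of these vectors, grouped by degree, is a
decomposition of [0], so each group vanishes by uniqueness of decompositions. *)
Lemma exists_homogeneous_basis (G : zmodType) (F : fieldType) (V : lmodType F)
    (V_ : G -> set V) : direct_sum V_ -> (forall g, fin_dim (V_ g)) ->
  exists (I : choiceType) (tg : I -> G) (e : I -> V),
    [/\ basis e, forall i, V_ (tg i) (e i),
        forall g, exists r : seq I, forall i, tg i = g -> i \in r &
        forall g v i, V_ g v -> tg i != g -> coordinate e v i = 0].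
Proof.
move=> [V_sub V_dec] V_fin.
pose B g := cid (fin_dim_free (V_fin g)); pose d g := sval (B g).
pose b g : 'I_(d g) -> V := sval (cid (svalP (B g))).
have bP g : V_ g = lspan (range (b g)) /\ forall c : 'I_(d g) -> F,
    \sum_i c i *: b g i = 0 -> forall i, c i = 0 := svalP (cid (svalP (B g))).
pose I : choiceType := {g : G & 'I_(d g)}.
pose e (i : I) := b (tag i) (tagged i).
have eV i : V_ (tag i) (e i).
  by rewrite (bP (tag i)).1; apply: mem_lspan; exists (tagged i).
have e_basis : basis e.
  apply: basis_intro => [w|c].
    have [f [[f_fin fV ->] _]] := V_dec w; have [r r_uniq r0] := finite_supp_seq f_fin.
    rewrite (fsum_seq r_uniq r0); apply: (lin_closed_sum _ (lspan_closed _)) => g _.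
    have := fV g; rewrite (bP g).1; apply: (lspan_min (lspan_closed _)) => _ [k _ <-].
    by apply: mem_lspan; exists (Tagged (fun g => 'I_(d g)) k).
  move=> [/finite_supp_seq[r r_uniq r0] sum0].
  rewrite (fsum_seq r_uniq) in sum0; last by move=> i /r0->; rewrite scale0r.
  pose f g := \sum_(k < d g) c (Tagged _ k) *: b g k.
  have fE g : f g = \sum_(x <- r | tag x == g) c x *: e x.
    pose h (x : I) := if tag x == g then c x *: e x else 0.
    pose q : seq I := [seq Tagged (fun g => 'I_(d g)) k | k : 'I_(d g)].
    rewrite big_mkcond -(fsum_seq r_uniq (f := h)); last first.
      by move=> x /r0 cx; rewrite /h cx scale0r if_same.
    rewrite (fsum_seq (r := q)) /q ?big_image /=; first 1 last.
    - rewrite map_inj_uniq ?enum_uniq // => k1 k2 /eqP.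
      by rewrite -tag_eqE /tag_eq /= eqxx tagged_asE => /eqP.
    - move=> [g' k] /= xq; rewrite /h; case: (g' =P g) => // gg.
      by subst g'; rewrite codom_f in xq.
    by apply: eq_bigr => k _; rewrite /h eqxx.
  have f_dec : decomposition V_ 0 f.
    have f0 g : g \notin undup (map tag r) -> f g = 0.
      rewrite mem_undup fE => gr; rewrite big_seq_cond big1 // => x /andP[xr /eqP xg].
      by rewrite -xg map_f in gr.
    split; first exact: seq_finite_supp f0.
      move=> g; rewrite (bP g).1; apply: (lin_closed_sum _ (lspan_closed _)) => k _.
      by apply: lin_closedZ (lspan_closed _) _; apply: mem_lspan; exists k.
    rewrite (fsum_seq (undup_uniq _) f0); apply: (etrans sum0).
    under [RHS]eq_bigr do rewrite fE.
    rewrite (exchange_big_dep xpredT) //= [LHS]big_seq [RHS]big_seq; apply: eq_bigr => x xr.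
    rewrite big_mkcond (bigD1_seq (tag x)) ?undup_uniq ?mem_undup ?map_f //= eqxx.
    by rewrite big1 ?addr0 // => g; rewrite eq_sym => /negPf->.
  have f_eq0 : f = fun=> 0.
    have [f' [_ f'_uniq]] := V_dec 0; rewrite -(f'_uniq _ f_dec); apply: f'_uniq.
    split; first by apply: (@seq_finite_supp _ _ _ [::]).
      by move=> g; have /subspaceP[] := V_sub g.
    by rewrite (@fsum_seq _ _ _ [::]) // big_nil.
  move=> [g k]; have /(bP g).2 := congr1 (@^~ g) f_eq0; exact.
exists I, tag, e; split=> // [g|g v i].
  exists [seq Tagged (fun g => 'I_(d g)) k | k : 'I_(d g)] => -[g' k] /= gg.
  by subst g'; rewrite codom_f.
rewrite (bP g).1 => vV gi; move: v vV.
apply: (@lspan_min _ _ _ [set v | coordinate e v i = 0]).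
  split=> [|a u v /= u0 v0]; first by rewrite /= coordinate0.
  by rewrite coordinate_lin // u0 v0 mulr0 addr0.
move=> _ [k _ <-] /=; rewrite -[b g k]/(e (Tagged (fun g => 'I_(d g)) k)).
rewrite coordinate_basis //; case: eqP => // ik; by rewrite ik eqxx in gi.
Qed.

(** * Total orders on index sets *)

Definition is_total_order (I : Type) (le : rel I) : Prop :=
  [/\ reflexive le, antisymmetric le, transitive le & total le].

(** A copy of [I] that carries the order [le] as its canonical order. *)
Definition ordered_by (I : choiceType) (le : rel I) (le_order : is_total_order le) :
  Type := I.

Section OrderedBy.
Variables (I : choiceType) (le : rel I) (le_order : is_total_order le).
Local Notation J := (ordered_by le_order).

Let le_refl : reflexive le. Proof. by case: le_order. Qed.
Let le_anti : antisymmetric le. Proof. by case: le_order. Qed.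
Let le_trans : transitive le. Proof. by case: le_order. Qed.
Let le_total : total le. Proof. by case: le_order. Qed.

HB.instance Definition _ := Choice.on J.
HB.instance Definition _ :=
  Order.Le_isPOrder.Build (Order.Disp tt tt) J le_refl le_anti le_trans.
HB.instance Definition _ := Order.POrder_isTotal.Build (Order.Disp tt tt) J le_total.
End OrderedBy.

(** The copy inherits the choice structure of [I], but the two structures are
convertible only once [I] is an explicit record; hence the case analysis in this
lemma and the next. *)
Lemma basis_ordered_by (F : fieldType) (W : lmodType F) (I : choiceType)
    (le : rel I) (le_order : is_total_order le) (e : I -> W) :
  basis e -> basis (e : ordered_by le_order -> W).
Proof. by destruct I. Qed.

Lemma coordinate_ordered_by (F : fieldType) (W : lmodType F) (I : choiceType)
    (le : rel I) (le_order : is_total_order le) (e : I -> W) w i :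
  coordinate (e : ordered_by le_order -> W) w i = coordinate e w i.
Proof. by destruct I. Qed.

(** Reversing [js] turns lower triangular matrices on the block into upper
triangular ones; outside [js] any well-order of [I] will do. *)
Lemma exists_total_order (I : choiceType) (js : seq I) : exists2 le : rel I,
  is_total_order le &
  forall i k, i \in js -> k \in js -> le i k = (index k js <= index i js)%N.
Proof.
have [R wo] := well_ordering_principle I.
have minP x y z : exists m, [/\ m \in [:: x; y; z], R m x, R m y & R m z].
  have [|m [[mxyz m_min] _]] := wo [in [:: x; y; z]].
    by exists x; rewrite !inE eqxx.
  by exists m; split=> //; apply: m_min; rewrite !inE eqxx ?orbT.
have R_refl x : R x x.
  by have [m [+ Rmx _ _]] := minP x x x; rewrite !inE !orbb => /eqP mx; rewrite -{1}mx.
have R_total x y : R x y || R y x.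
  have [m [+ Rmx Rmy _]] := minP x y y; rewrite !inE orbb.
  by case/orP=> /eqP mE; subst m; rewrite ?Rmx ?Rmy ?orbT.
have R_anti x y : R x y -> R y x -> x = y.
  move=> Rxy Ryx; have [|m [_ m_uniq]] := wo [in [:: x; y]].
    by exists x; rewrite !inE eqxx.
  rewrite -(m_uniq x) ?(m_uniq y) //; split; rewrite ?inE ?eqxx ?orbT // => z;
    by rewrite !inE => /orP[]/eqP->.
have R_trans x y z : R x y -> R y z -> R x z.
  move=> Rxy Ryz; have [m [+ Rmx Rmy Rmz]] := minP x y z.
  rewrite !inE => /or3P[]/eqP mE; subst m => //; first by rewrite (R_anti _ _ Rxy).
  by rewrite -(R_anti _ _ Ryz).
exists (fun i k => if i \in js then (k \in js) ==> (index k js <= index i js)%N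
                  else (k \notin js) && R i k); first split.
- by move=> i; case: (i \in js); rewrite /= ?leqnn ?R_refl.
- move=> i k; have [ij|ij] := boolP (i \in js); have [kj|kj] := boolP (k \in js) => //=.
    by rewrite -eqn_leq => /eqP/(congr1 (nth i js)); rewrite !nth_index.
  by move=> /andP[]; apply: R_anti.
- move=> k i l; have [ij|ij] := boolP (i \in js); have [kj|kj] := boolP (k \in js);
    have [lj|lj] := boolP (l \in js) => //=.
    by move=> ik kl; apply: leq_trans kl ik.
  exact: R_trans.
- move=> i k; have [ij|ij] := boolP (i \in js); have [kj|kj] := boolP (k \in js) => //=.
  exact: leq_total.
by move=> i k /= -> ->.
Qed.

(** * Operators supported on finitely many basis vectors *)

Section FiniteBlock.
Variables (F : fieldType) (V : lmodType F) (I : choiceType) (e : I -> V).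
Hypothesis e_basis : basis e.
Variable js : seq I.
Hypothesis js_uniq : uniq js.
Local Notation n := (size js).
Implicit Types (w : V) (u : 'cV[F]_n) (a b : V -> V).

Let jn (k : 'I_n) : I := tnth (in_tuple js) k.

Let jn_mem k : jn k \in js. Proof. exact: mem_tnth. Qed.

Let jn_inj : injective jn.
Proof. by move=> k l /(tuple_uniqP (in_tuple js) js_uniq). Qed.

Definition block_coord w : 'cV[F]_n := \col_k coordinate e w (jn k).

Definition block_vec u : V := \sum_l u l 0 *: e (jn l).

Lemma block_coord_lin : linear block_coord.
Proof. by move=> c u w; apply/colP => k; rewrite !mxE coordinate_lin. Qed.

Lemma block_vec_lin : linear block_vec.
Proof.
move=> c u w; rewrite /block_vec scaler_sumr -big_split; apply: eq_bigr => l _ /=.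
by rewrite !mxE scalerDl scalerA.
Qed.

HB.instance Definition _ :=
  GRing.isLinear.Build F V 'cV[F]_n *:%R block_coord block_coord_lin.
HB.instance Definition _ :=
  GRing.isLinear.Build F 'cV[F]_n V *:%R block_vec block_vec_lin.

Lemma block_vec_sum u : block_vec u = \sum_(i <- js) (\sum_(l | jn l == i) u l 0) *: e i.
Proof.
rewrite (big_tnth _ _ js); apply: eq_bigr => l _.
rewrite (big_pred1 l) // => k; exact: (inj_eq jn_inj).
Qed.

Lemma coordinate_block_vec u i :
  coordinate e (block_vec u) i = \sum_(l | jn l == i) u l 0.
Proof.
rewrite (@coordinateE _ _ _ _ e_basis _ (fun i => \sum_(l | jn l == i) u l 0)) //.
apply/(coordinates_seq _ _ js_uniq) => [k kj|]; last exact: block_vec_sum.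
by rewrite big1 // => l /eqP lk; rewrite -lk jn_mem in kj.
Qed.

Lemma coordinate_block_vec_out u i : i \notin js -> coordinate e (block_vec u) i = 0.
Proof.
by move=> ij; rewrite coordinate_block_vec big1 // => l /eqP li; rewrite -li jn_mem in ij.
Qed.

Lemma block_vecK : cancel block_vec block_coord.
Proof.
move=> u; apply/colP => k; rewrite mxE coordinate_block_vec (big_pred1 k) // => l.
exact: (inj_eq jn_inj).
Qed.

Lemma block_coordK w : (forall i, i \notin js -> coordinate e w i = 0) ->
  block_vec (block_coord w) = w.
Proof.
move=> w0; rewrite [RHS](coordinate_sum e_basis js_uniq w0) (big_tnth _ _ js).
by apply: eq_bigr => l _; rewrite mxE.
Qed.

Lemma block_coord_out i : i \notin js -> block_coord (e i) = 0.
Proof.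
move=> ij; apply/colP => k; rewrite !mxE coordinate_basis //.
by case: eqP => // ki; rewrite -ki jn_mem in ij.
Qed.

Lemma block_vec_delta k : block_vec (delta_mx k 0) = e (jn k).
Proof.
rewrite /block_vec (bigD1 k) //= big1 ?addr0 => [|l lk]; rewrite mxE ?eqxx ?scale1r //.
by rewrite (negPf lk) scale0r.
Qed.

Lemma block_coord_basis k : block_coord (e (jn k)) = delta_mx k 0.
Proof. by rewrite -block_vec_delta block_vecK. Qed.

Definition supported a := [/\ linear a, forall i, i \notin js -> a (e i) = 0 &
  forall w i, i \notin js -> coordinate e (a w) i = 0].

Definition block_matrix a : 'M[F]_n := \matrix_(l, k) coordinate e (a (e (jn k))) (jn l).

Lemma block_matrixP a w : supported a -> block_coord (a w) = block_matrix a *m block_coord w.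
Proof.
case=> /exists_linear[{}a ->] a0 _; move: w.
apply: (@linear_basis_ext _ _ _ _ e_basis _ (block_coord \o a)
  (mulmx (block_matrix a) \o block_coord)); try exact: linearP.
move=> i /=; have [/tnthP[k ->]|ij] := boolP (i \in in_tuple js); last first.
  by rewrite a0 // block_coord_out // linear0 mulmx0.
rewrite -/(jn k) block_coord_basis -colE.
by apply/colP => l; rewrite !mxE.
Qed.

Lemma supportedE a w : supported a ->
  a w = block_vec (block_matrix a *m block_coord w).
Proof.
by move=> sa; have [_ _ out] := sa; rewrite -block_matrixP // block_coordK //; apply: out.
Qed.

(** The matrix on the block is determined by its action on block coordinates, so
matrices of composites and of brackets need no entrywise computation. *)
Lemma block_matrix_uniq a (M : 'M[F]_n) :
  (forall w, block_coord (a w) = M *m block_coord w) -> block_matrix a = M.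
Proof.
move=> aM; apply/matrixP => l k; have := aM (e (jn k)).
by rewrite block_coord_basis -colE => /colP/(_ l); rewrite !mxE.
Qed.

Lemma mulmx_inj0 (M : 'M[F]_n) : (forall w, M *m block_coord w = 0) -> M = 0.
Proof.
move=> M0; apply/matrixP => l k; have := M0 (e (jn k)).
by rewrite block_coord_basis -colE => /colP/(_ l); rewrite !mxE.
Qed.

(** The automorphism of the space that acts by [P] on the span of the basis vectors
in [js] and by the identity on the other basis vectors. *)
Definition block_aut (P : 'M[F]_n) w : V := w + block_vec ((P - 1%:M) *m block_coord w).

Lemma block_aut_lin P : linear (block_aut P).
Proof.
move=> c u w; rewrite /block_aut linearP mulmxDr -scalemxAr linearP scalerDr.
by rewrite addrACA.
Qed.

Lemma block_aut_vec P u : block_aut P (block_vec u) = block_vec (P *m u).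
Proof. by rewrite /block_aut block_vecK -linearD /= mulmxBl mul1mx addrC subrK. Qed.

Lemma block_aut_coord P w : block_coord (block_aut P w) = P *m block_coord w.
Proof. by rewrite /block_aut linearD /= block_vecK mulmxBl mul1mx addrC subrK. Qed.

Lemma block_aut_out P i : i \notin js -> block_aut P (e i) = e i.
Proof. by move=> ij; rewrite /block_aut block_coord_out // mulmx0 linear0 addr0. Qed.

Lemma block_autK P Q : Q *m P = 1%:M -> cancel (block_aut P) (block_aut Q).
Proof.
move=> QP w; rewrite {1}/block_aut block_aut_coord mulmxA mulmxBl mul1mx QP.
by rewrite /block_aut -addrA -linearD /= -mulmxDl addrA subrK subrr mul0mx linear0 addr0.
Qed.

Lemma conjugate_coordinate P Q a i k : Q *m P = 1%:M -> P *m Q = 1%:M ->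
  supported a ->
  coordinate (block_aut P \o e) (a (block_aut P (e i))) k =
  coordinate e (block_vec (Q *m (block_matrix a *m P) *m block_coord (e i))) k.
Proof.
move=> QP PQ sa.
have [_ ->] := basis_automorphism e_basis (@block_aut_lin P) (@block_aut_lin Q)
  (block_autK QP) (block_autK PQ).
by rewrite (supportedE _ sa) block_aut_coord block_aut_vec !mulmxA.
Qed.

(** Only pairs of indices of [js] contribute: [a] kills the basis vectors outside
[js] and its image has no coordinate there. *)
Lemma conjugate_triangular P Q a i k : Q *m P = 1%:M -> P *m Q = 1%:M ->
  supported a ->
  (forall l m : 'I_n, (l < m)%N -> (Q *m (block_matrix a *m P)) l m = 0) ->
  (i \in js -> k \in js -> (index k js < index i js)%N) ->
  coordinate (block_aut P \o e) (a (block_aut P (e i))) k = 0.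
Proof.
move=> QP PQ sa tri lt_ki; rewrite (conjugate_coordinate _ _ QP PQ sa).
have [kj|kj] := boolP (k \in js); last by rewrite coordinate_block_vec_out.
have [ij|ij] := boolP (i \in js); last first.
  by rewrite block_coord_out // mulmx0 linear0 coordinate0.
have ltj x : x \in js -> (index x js < n)%N by rewrite index_mem.
pose ox x (xj : x \in js) := Ordinal (ltj x xj).
have jE x (xj : x \in js) : jn (ox x xj) = x.
  by rewrite /jn (tnth_nth x) nth_index.
rewrite -(jE i ij) -(jE k kj) block_coord_basis -colE coordinate_block_vec.
rewrite (big_pred1 (ox k kj)) => [|l]; last exact: (inj_eq jn_inj).
by rewrite mxE tri //= lt_ki.
Qed.

End FiniteBlock.

(** * Degrees and brackets of endomorphisms *)

Lemma lin_closed_linear (F : fieldType) (V : lmodType F) :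
  lin_closed [set a : V -> V | linear a].
Proof.
split=> [c u v|c a b a_lin b_lin d u v].
  exact/esym/(etrans (addr0 _))/scaler0.
rewrite !fctE a_lin b_lin !scalerDr !scalerA [d * c]mulrC.
by rewrite addrACA.
Qed.

Section ColorAlgebra.
Variables (G : zmodType) (F : fieldType) (r : G -> G -> F).
Variables (V : lmodType F) (V_ : G -> set V).
Hypothesis V_graded : direct_sum V_.
Implicit Types (a b : V -> V) (g h : G).

Let V_closed g : lin_closed (V_ g).
Proof. by apply/subspaceP; case: V_graded. Qed.

Definition shifts_degree g a := forall h v, V_ h v -> V_ (h + g) (a v).

Lemma shifts_degree_closed g : lin_closed [set a | shifts_degree g a].
Proof.
split=> [h v _|c a b sa sb h v hv]; first exact: (V_closed _).1.
by apply: (V_closed _).2; [apply: sa|apply: sb].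
Qed.

Lemma gl_linear a : gl V_ a -> linear a.
Proof.
by apply: (lspan_min (lin_closed_linear V)) => b [i [j []]].
Qed.

Lemma gl_shifts g a : gl_ V_ g a -> shifts_degree g a.
Proof.
apply: (lspan_min (shifts_degree_closed g)) => b [i [j [-> [_ b_ji b_0]]]] h v hv.
have [hj|hj] := eqVneq h j; first by rewrite hj in hv *; apply: b_ji.
by rewrite (b_0 h) //; [apply: (V_closed _).1|apply/eqP].
Qed.

Lemma gl_component_gl g : gl_ V_ g `<=` gl V_.
Proof.
apply: (lspan_min (lspan_closed _)) => b [i [j [_ bij]]].
by apply: mem_lspan; exists i, j.
Qed.

Lemma homogeneous_ext a b : linear a -> linear b ->
  (forall h v, V_ h v -> a v = b v) -> a = b.
Proof.
move=> /exists_linear[{}a ->] /exists_linear[{}b ->] ab; apply/funext => v.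
have [f [[f_fin fV ->] _]] := V_graded.2 v.
have [q q_uniq q0] := finite_supp_seq f_fin.
by rewrite (fsum_seq q_uniq q0) !linear_sum; apply: eq_bigr => g _; apply: ab (fV g).
Qed.

(** On [V_ h] the components of [a v] of degree [h + k] are the [f k v], and [a v] is
homogeneous of degree [h + g]; uniqueness of decompositions in [V] therefore
identifies every [f k].  This makes homogeneity in [gl] a matter of degrees
in [V]. *)
Lemma decomposition_shift g a f : linear a -> shifts_degree g a ->
  decomposition (gl_ V_) a f -> f = fun h => if h == g then a else 0.
Proof.
move=> a_lin ag [/finite_supp_seq[q q_uniq q0] f_gl]; rewrite (fsum_seq q_uniq q0) => aE.
apply/funext => k; apply: homogeneous_ext => [||h v hv].
- by apply: gl_linear; apply: gl_component_gl (f_gl k).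
- by case: ifP => // _; apply: (lin_closed_linear V).1.
have [f' [_ f'_uniq]] := V_graded.2 (a v).
have d1 : decomposition V_ (a v) (fun m => f (m - h) v).
  have supp m : m \notin [seq h + k | k <- q] -> f (m - h) v = 0.
    move=> mq; rewrite q0 //; apply: contra mq => mq; apply/mapP; exists (m - h) => //.
    by rewrite addrC subrK.
  split; first exact: seq_finite_supp supp.
    by move=> m; rewrite -{1}[m](subrK h) addrC; apply: gl_shifts (f_gl _) _ _ hv.
  have hq_uniq : uniq [seq h + k | k <- q] by rewrite map_inj_uniq //; apply: addrI.
  rewrite (fsum_seq hq_uniq supp) {1}aE fct_sumE big_map; apply: eq_bigr => i _.
  by rewrite addrC addKr.
have d2 : decomposition V_ (a v) (fun m => if m == h + g then a v else 0).
  have supp m : m \notin [:: h + g] -> (if m == h + g then a v else 0) = 0.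
    by rewrite inE => /negPf->.
  split; first exact: seq_finite_supp supp.
    by move=> m; case: eqP => [->|_]; [apply: ag|apply: (V_closed _).1].
  by rewrite (fsum_seq _ supp) // big_seq1 eqxx.
have /(congr1 (@^~ (k + h))) : (fun m => f (m - h) v) =
    (fun m => if m == h + g then a v else 0).
  by rewrite -(f'_uniq _ d1) -(f'_uniq _ d2).
rewrite /= addrK => ->; rewrite [k + h]addrC (inj_eq (addrI h)).
by case: ifP.
Qed.

Section Subalgebra.
Variable L : set (V -> V).
Hypothesis L_sub : lie_color_subalgebra r V_ L.

Let L_gl : L `<=` gl V_. Proof. by case: L_sub. Qed.

Let L_dec a : L a -> exists2 f, decomposition (gl_ V_) a f & forall g, L (f g).
Proof. by case: L_sub => _ [_ dec] _; apply: dec. Qed.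

Lemma shifts_gl g a : L a -> shifts_degree g a -> gl_ V_ g a.
Proof.
move=> La ag; have [f f_dec _] := L_dec La.
have fE := decomposition_shift (gl_linear (L_gl La)) ag f_dec.
by case: f_dec => _ /(_ g); rewrite fE eqxx.
Qed.

(** For homogeneous arguments only one term of the bilinear extension survives. *)
Lemma bracket_shift g h a b : L a -> L b -> shifts_degree g a -> shifts_degree h b ->
  bracket r V_ a b = a \o b - r h g *: (b \o a).
Proof.
move=> La Lb ag bh.
have comp k c : L c -> shifts_degree k c ->
    component (gl_ V_) c = fun m => if m == k then c else 0.
  move=> Lc ck; apply: (decomposition_shift (gl_linear (L_gl Lc)) ck).
  by apply: xgetPex; have [f f_dec _] := L_dec Lc; exists f.
have [a_lin b_lin] := (gl_linear (L_gl La), gl_linear (L_gl Lb)).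
have lin0 (c : V -> V) : linear c -> c \o 0 = 0 :> (V -> V).
  by move=> /exists_linear[{}c ->]; apply/funext => v; rewrite /= linear0.
rewrite /bracket (comp g a) // (comp h b) // (@fsum_seq _ _ _ [:: g]) // => [|k].
  rewrite big_seq1 eqxx (@fsum_seq _ _ _ [:: h]) // => [|m].
    by rewrite big_seq1 eqxx.
  rewrite inE => /negPf->; rewrite lin0 //; apply/funext => v.
  by rewrite !fctE scaler0 subr0.
rewrite inE => /negPf->; rewrite (@fsum_seq _ _ _ [::]) ?big_nil // => m _.
have -> : (if m == h then b else 0) \o 0 = 0 :> (V -> V).
  by case: ifP => // _; apply: lin0.
by apply/funext => v; rewrite !fctE scaler0 subr0.
Qed.

Lemma bracket_shifts g h a b : L a -> L b -> shifts_degree g a -> shifts_degree h b ->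
  shifts_degree (g + h) (bracket r V_ a b).
Proof.
move=> La Lb ag bh k v kv; rewrite (bracket_shift La Lb ag bh) !fctE addrC -scaleNr.
apply: (V_closed _).2; first by rewrite addrA; apply/bh/ag.
by rewrite [g + h]addrC addrA; apply/ag/bh.
Qed.

End Subalgebra.

Variables (I : choiceType) (tg : I -> G) (e : I -> V).
Hypothesis e_basis : basis e.
Hypothesis tg_finite : forall g, exists q : seq I, forall i, tg i = g -> i \in q.
Hypothesis e_deg : forall i, V_ (tg i) (e i).
Hypothesis tgP : forall g v i, V_ g v -> tg i != g -> coordinate e v i = 0.

Lemma supported_sub (js ks : seq I) a : {subset js <= ks} ->
  supported e js a -> supported e ks a.
Proof.
move=> sub [a_lin a0 a_out]; split=> // [i ik|v i ik]; [apply: a0|apply: a_out];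
  exact: contra (sub i) ik.
Qed.

Lemma supported_closed js : lin_closed [set a | supported e js a].
Proof.
split=> [|c a b [a_lin a0 a_out] [b_lin b0 b_out]]; split.
- exact: (lin_closed_linear V).1.
- by [].
- by move=> v i _; rewrite coordinate0.
- exact: (lin_closed_linear V).2.
- by move=> i ij; rewrite !fctE a0 // b0 // scaler0 addr0.
- by move=> v i ij; rewrite coordinate_lin // a_out // b_out // mulr0 addr0.
Qed.

(** A block between [V_ h] and [V_ g] only involves the finitely many basis vectors
of degrees [g] and [h]. *)
Lemma gl_supported a : gl V_ a -> exists js, supported e js a.
Proof.
apply: (@lspan_min _ _ _ [set a | exists js, supported e js a]).
  split=> [|c {}a b [js sa] [ks sb]].
    by exists [::]; apply: (supported_closed _).1.
  exists (js ++ ks); apply: (supported_closed _).2;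
    [apply: supported_sub sa|apply: supported_sub sb];
    by move=> i; rewrite mem_cat => ->; rewrite ?orbT.
move=> b [g [h [b_lin b_deg b_0]]].
have [js jsP] := tg_finite g; have [ks ksP] := tg_finite h.
have b_e i : i \notin ks -> b (e i) = 0.
  by move=> ik; apply: (b_0 (tg i)) => //; apply: contraNnot ik => /ksP.
exists (js ++ ks); split=> // [i|w i]; rewrite mem_cat negb_or => /andP[ij ik].
  exact: b_e.
have [b' b'E] := exists_linear b_lin.
have [q _ ->] := basis_span e_basis w; rewrite b'E linear_sum.
apply: (@lin_closed_sum _ _ [set v | coordinate e v i = 0]).
  split=> [|c u v /= u0 v0]; first by rewrite /= coordinate0.
  by rewrite coordinate_lin // u0 v0 mulr0 addr0.
move=> k _ /=; rewrite linearZ -b'E /= -[_ *: _]addr0 coordinate_lin // coordinate0 //.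
rewrite addr0; have [kh|kh] := eqVneq (tg k) h.
  rewrite (tgP (b_deg _ _)) ?mulr0 //; first by rewrite -kh.
  by apply: contraNneq ij => /jsP.
by rewrite (b_0 _ _ _ (e_deg k)) ?coordinate0 ?mulr0 //; apply/eqP.
Qed.

End ColorAlgebra.

(** * Flags *)

Lemma upper_triangular_stabilizes (F : fieldType) (V : lmodType F) (d : Order.disp_t)
    (I : orderType d) (e : I -> V) (L : set (V -> V)) : basis e ->
  (forall a, L a -> linear a) -> (forall a, L a -> upper_triangular e a) ->
  stabilizes L (flag_of e).
Proof.
move=> e_basis L_lin L_tri a _ La [D D_seg ->] _ [w wD <-]; move: w wD.
have [a' a'E] := exists_linear (L_lin a La).
apply: (@lspan_min _ _ _ [set w | lspan (e @` D) (a w)]).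
  rewrite a'E; split=> [|c u v /= ua va]; first by rewrite /= linear0; case: (lspan_closed (e @` D)).
  by rewrite linearP; apply: (lspan_closed _).2.
move=> _ [j Dj <-] /=; have [q _ ->] := basis_span e_basis (a (e j)).
apply: (lin_closed_sum _ (lspan_closed _)) => i _.
have [lt_ji|le_ij] := ltP j i.
  by rewrite (L_tri a La i j lt_ji) scale0r; case: (lspan_closed (e @` D)).
apply: (lin_closedZ _ (lspan_closed _)); apply: mem_lspan; exists i => //.
exact: D_seg Dj le_ij.
Qed.

Theorem corollary1p6 (G : zmodType) (F : fieldType)
    (closedF : GRing.closed_field_axiom F)
    (r : G -> G -> F) (r_bichar : skew_bicharacter r)
    (V : lmodType F) (V_ : G -> set V)
    (V_graded : direct_sum V_) (V_fin : forall g, fin_dim (V_ g))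
    (L : set (V -> V)) (L_sub : lie_color_subalgebra r V_ L)
    (L_fin : fin_dim L) (L_solv : lie_solvable r V_ L)
    (L_nil : forall x, brackets r V_ L x -> homogeneous (gl_ V_) x ->
                       nilpotent_end x)
    (G_tf : torsion_free G) :
  (exists fl : set (set V), color_flag V_ fl /\ stabilizes L fl) /\
  (exists (d : Order.disp_t) (I : orderType d) (e : I -> V),
     homogeneous_basis V_ e /\ forall x, L x -> upper_triangular e x).
Proof.
have [I [tg [e [e_basis e_deg tg_fin tgP]]]] := exists_homogeneous_basis V_graded V_fin.
have [L_gl [_ L_dec] L_br] := L_sub.
have [js js_uniq L_supp] : exists2 js, uniq js & forall a, L a -> supported e js a.
  have [m [s Ls]] := L_fin.
  have ex k : exists js, supported e js (s k).
    apply: (gl_supported e_basis tg_fin e_deg tgP); apply: L_gl.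
    by rewrite Ls; apply: mem_lspan; exists k.
  pose js k := sval (cid (ex k)).
  exists (undup (flatten [seq js k | k : 'I_m])); first exact: undup_uniq.
  rewrite Ls; apply: (lspan_min (supported_closed e_basis _)) => _ [k _ <-].
  apply: supported_sub (svalP (cid (ex k))) => i ik; rewrite mem_undup.
  by apply/flattenP; exists (js k); rewrite ?codom_f.
pose deg k := tg (tnth (in_tuple js) k).
pose H g X := exists a, [/\ L a, shifts_degree V_ g a & X = block_matrix e js a].
have r00 : r 0 0 = 1.
  have [r_neq0 rD _ _] := r_bichar; apply: (mulfI (r_neq0 0 0)).
  by rewrite -rD addr0 mulr1.
have H_deg g X : H g X -> forall i j, X i j != 0 -> deg i = deg j + g.
  move=> [a [La ag ->]] i j; rewrite mxE => nz; apply/eqP/negPn/negP => deg_ij.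
  by case/eqP: nz; apply: tgP deg_ij; apply/ag/e_deg.
have bracket_mx g h a b : L a -> L b -> shifts_degree V_ g a -> shifts_degree V_ h b ->
    block_matrix e js (bracket r V_ a b) =
    block_matrix e js a *m block_matrix e js b -
      r h g *: (block_matrix e js b *m block_matrix e js a).
  move=> La Lb ag bh; apply: (block_matrix_uniq e_basis js_uniq) => w.
  rewrite (bracket_shift V_graded L_sub La Lb ag bh) !fctE.
  rewrite addrC -scaleNr (block_coord_lin e_basis js) !block_matrixP //; try exact: L_supp.
  by rewrite addrC mulmxBl scaleNr -scalemxAl !mulmxA.
have H_br g h X Y : H g X -> H h Y -> H (g + h) (X *m Y - r h g *: (Y *m X)).
  move=> [a [La ag ->]] [b [Lb bh ->]]; exists (bracket r V_ a b).
  by split; [apply: L_br|apply: (bracket_shifts V_graded L_sub)|rewrite (bracket_mx g h)].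
have H_nil g h X Y : H g X -> H h Y ->
    exists m, iter m (mulmx (X *m Y - r h g *: (Y *m X))) 1%:M = 0.
  move=> [a [La ag ->]] [b [Lb bh ->]]; rewrite -bracket_mx //.
  have L_ab := L_br a b La Lb; set x := bracket r V_ a b.
  have [||m xm] := L_nil x.
  - by apply: mem_lspan; exists a, b.
  - exists (g + h); apply: (shifts_gl V_graded L_sub) => //.
    exact: (bracket_shifts V_graded L_sub).
  exists m; apply: (mulmx_inj0 e_basis js_uniq) => w.
  (* Block coordinates intertwine x with its matrix, so powers of the matrix
     vanish together with the iterates of x. *)
  have iterE k : iter k (mulmx (block_matrix e js x)) 1%:M *m block_coord e js w =
      block_coord e js (iter k x w).
    elim: k => [|k IHk]; first by rewrite mul1mx.
    by rewrite /= -mulmxA IHk -block_matrixP //; apply: L_supp.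
  by rewrite iterE xm; apply/colP => k; rewrite !mxE coordinate0.
have [P [Q [QP P_hom tri]]] :=
  graded_triangularization (c := fun g h => r h g) closedF G_tf r00 H_deg H_br H_nil.
have PQ : P *m Q = 1%:M by apply: mulmx1C.
have [le le_order le_js] := exists_total_order js.
pose J : orderType _ := ordered_by le_order.
pose e' : J -> V := block_aut e P \o e.
have e'_basis : basis e'.
  have [Pe_basis _] := basis_automorphism e_basis (block_aut_lin e_basis P)
    (block_aut_lin e_basis Q) (block_autK e_basis js_uniq QP)
    (block_autK e_basis js_uniq PQ).
  exact: basis_ordered_by Pe_basis.
have e'_hom : homogeneous_basis V_ e'.
  split=> // i; have [/tnthP[k ->]|ij] := boolP (i \in in_tuple js); last first.
    by exists (tg i); rewrite /e' /= block_aut_out.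
  have [g gP] := P_hom k; exists g; rewrite /e' /= -(block_vec_delta e) block_aut_vec // -colE.
  have Vg_closed : lin_closed (V_ g) by apply/subspaceP; case: V_graded.
  apply: (lin_closed_sum _ Vg_closed) => l _; rewrite mxE.
  have [->|/gP <-] := eqVneq (P l k) 0; first by rewrite scale0r; case: Vg_closed.
  by apply: lin_closedZ (e_deg _); apply/subspaceP; case: V_graded.
have L_tri x : L x -> upper_triangular e' x.
  move=> Lx i j lt_ji; have [f [f_fin f_gl ->] Lf] := L_dec x Lx.
  have [q q_uniq q0] := finite_supp_seq f_fin.
  rewrite (fsum_seq q_uniq q0) fct_sumE.
  apply: (@lin_closed_sum _ _ [set v | coordinate e' v i = 0]) => [|g _ /=].
    split=> [|c u v /= u0 v0]; first exact: coordinate0.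
    by rewrite coordinate_lin // u0 v0 mulr0 addr0.
  have := @conjugate_triangular F V I e e_basis js js_uniq P Q (f g) j i QP PQ.
  move=> /(_ (L_supp _ (Lf g))) conj0; rewrite coordinate_ordered_by.
  apply: conj0 => [l m|jj ij].
    by apply: (tri g); exists (f g); split=> //; apply: (gl_shifts V_graded).
  rewrite ltnNge -le_js //; apply/negP => le_ij.
  by move: lt_ji; rewrite ltNge; apply/negP/negPn.
split.
  exists (flag_of e'); split; first by exists _, J, e'.
  by apply: upper_triangular_stabilizes => // a /L_supp[].
by exists _, J, e'.
Qed.
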